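(* Let $(W,S)$ be a finite Coxeter system and let $a\in\Sigma^+(W)$. Then $$a\,\Sigma(W)=\Sigma_{\mathcal{F}_{\mathrm{eq}}(a)}(W).$$ In particular, $\Sigma(W)a\subset a\,\Sigma(W)$.
   Context: Let $(W,S)$ be a finite Coxeter system with length function $\ell$. For $I\subset S$, set $X_I=\{w\in W : \ell(ws)>\ell(w)\ \text{for all } s\in I\}$ and $x_I=\sum_{w\in X_I} w\in\mathbb{Q}W$. The Solomon descent algebra is $\Sigma(W)=\bigoplus_{I\subset S}\mathbb{Q}x_I$; it is a unital subalgebra of the group algebra $\mathbb{Q}W$, with basis $(x_I)_{I\subset S}$ (Solomon). For $x\in\Sigma(W)$ write $x=\sum_{I\subset S}\xi_I(x)x_I$. $\Sigma^+(W)$ is the set of $a\in\Sigma(W)$ with $\xi_I(a)\ge 0$ for all $I\subset S$. For a set $\mathcal{F}$ of subsets of $S$, $\Sigma_{\mathcal{F}}(W)=\bigoplus_{I\in\mathcal{F}}\mathbb{Q}x_I$. For $I,J\subset S$ write $I\equiv J$ if $J=wIw^{-1}$ for some $w\in W$; $\Lambda$ is the set of equivalence classes and $\boldsymbol{\lambda}(I)\in\Lambda$ is the class of $I$. For $\lambda,\mu\in\Lambda$ write $\lambda\subset\mu$ if there are $I\in\lambda$ and $J\in\mu$ with $I\subset J$. For $a\in\Sigma(W)$, $$\mathcal{F}_{\mathrm{eq}}(a)=\{I\subset S : \text{there exists } J\subset S \text{ with } \xi_J(a)\neq 0 \text{ and } \boldsymbol{\lambda}(I)\subset\boldsymbol{\lambda}(J)\}.$$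 *)

(* Defs.v *)
From HB Require Import structures.
From mathcomp Require Import all_boot all_order all_algebra.
From mathcomp Require Import all_fingroup all_solvable all_field all_character.

Set Implicit Arguments.
Unset Strict Implicit.
Unset Printing Implicit Defensive.

Import GRing.Theory.

Local Open Scope group_scope.

(* (W, S) is a Coxeter system in the sense of Bourbaki: S consists of elements
   of order 2 of W, generates W, and the relations (s t)^m(s,t) = 1, where
   m(s,t) is the order of s t in W, form a presentation of W.  The last clause
   is the universal property of that presentation, among all groups, not just
   the finite ones; uniqueness of phi on W follows from generation. *)
Definition coxeter_system (gT : finGroupType) (W : {group gT}) (S : {set gT}) :
    Prop :=
  [/\ <<S>> = W :> {set gT},
      forall s, s \in S -> #[s] = 2
    & forall (hT : groupType) (f : gT -> hT),
        (forall s t, s \in S -> t \in S -> (f s * f t) ^+ #[s * t] = 1) ->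
        exists2 phi : gT -> hT,
          {in W &, {morph phi : x y / x * y}} & {in S, phi =1 f}].

Lemma gen_expgn (gT : finGroupType) (S : {set gT}) (w : gT) :
  exists n, (w \in <<S>>) ==> (w \in S ^+ n).
Proof.
case: (boolP (w \in <<S>>)) => [/gen_prodgP[n [c Sc ->]]|_]; last by exists 0.
exists n; elim: n c Sc => [|n IHn] c Sc /=; first by rewrite big_ord0 set11.
rewrite big_ord_recl expgS; apply: mem_mulg; first exact: Sc.
by apply: IHn => i; apply: Sc.
Qed.

(* The set power S ^+ n is the set of products of n elements of S.  (The value
   is 0 when w is not generated by S.) *)
Definition coxlen (gT : finGroupType) (S : {set gT}) (w : gT) : nat :=
  ex_minn (gen_expgn S w).

Section DescentAlgebra.

Variables (gT : finGroupType) (W : {group gT}) (S : {set gT}).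

Definition Xset (I : {set gT}) : {set gT} :=
  [set w in W | [forall s in I, (coxlen S w < coxlen S (w * s))%N]].

(* MathComp realizes the group algebra QW inside 'M[rat]_#|W|, through the
   regular representation (group_ring rat W); gset_mx rat W A is the sum of the
   elements of A in it, and the product of QW is *m, in the same order. *)
Definition xelt (I : {set gT}) : 'M[rat]_#|W| := gset_mx rat W (Xset I).

Definition SigmaF (F : {set {set gT}}) : {vspace 'M[rat]_#|W|} :=
  (\sum_(I in F) <[xelt I]>)%VS.

Definition Sigma : {vspace 'M[rat]_#|W|} := SigmaF (powerset S).

Definition xtuple : #|powerset S|.-tuple 'M[rat]_#|W| :=
  [tuple xelt (enum_val i) | i < #|powerset S|].

Lemma set0_powerset : set0 \in powerset S.
Proof. by rewrite powersetE sub0set. Qed.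

(* Coordinates in the family (x_I), I \subset S, which is free when (W, S) is a
   Coxeter system.  For I \subset S, enum_rank_in set0_powerset I is the index
   of xelt I in xtuple; xi I is meaningless for other I. *)
Definition xi (I : {set gT}) (a : 'M[rat]_#|W|) : rat :=
  coord xtuple (enum_rank_in set0_powerset I) a.

Definition Sigma_plus (a : 'M[rat]_#|W|) : Prop :=
  a \in Sigma /\ forall I : {set gT}, I \subset S -> (0 <= xi I a)%R.

(* J = w I w^-1 for some w in W; in MathComp, A :^ x is x^-1 A x. *)
Definition cox_equiv (I J : {set gT}) : bool :=
  [exists w in W, J == I :^ w^-1].

Definition cox_class (I : {set gT}) : {set {set gT}} :=
  [set J in powerset S | cox_equiv I J].

Definition class_le (lam mu : {set {set gT}}) : bool :=
  [exists I in lam, [exists J in mu, I \subset J]].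

Definition Feq (a : 'M[rat]_#|W|) : {set {set gT}} :=
  [set I in powerset S |
    [exists J in powerset S,
      (xi J a != 0%R) && class_le (cox_class I) (cox_class J)]].

End DescentAlgebra.

(* Main.v *)
Require Import Defs.
From mathcomp Require Import all_boot all_order all_algebra.
From mathcomp Require Import all_fingroup all_solvable all_field all_character.

Set Implicit Arguments.
Unset Strict Implicit.
Unset Printing Implicit Defensive.

Import GRing.Theory Num.Theory.

Local Open Scope group_scope.

(** Everything rests on a Mackey formula for the basis elements,
      x_I x_J = sum_d x_(J :&: W_I ^ d),
    where d runs over the minimal representatives of the double cosets of the
    parabolic subgroups W_I = <<I>> and W_J = <<J>> (lemma mul_xelt).  The set
    K = J :&: W_I ^ d is contained in J, and it is conjugate to a subset of I
    (conj_simple_parabolic).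

    If a = sum_I xi_I x_I, the second property puts a x_J in the span of the
    x_K with K in Feq(a), for all J.  The first one makes left multiplication
    by a triangular for inclusion: the coefficient of x_J in the expansion
    of a x_J is the sum of xi_I over the pairs (I, d) such that J is contained
    in W_I ^ d.  As the xi_I are nonnegative nothing cancels, so that this
    coefficient is positive as soon as one such pair has xi_I <> 0, and one
    exists when J belongs to Feq(a) (exists_Xdouble).  By induction on #|J|,
    every x_J with J in Feq(a) lies in a Sigma(W).  Finally x_I a is a
    combination of elements x_K with K contained in some J such that
    xi_J <> 0, whence the inclusion of Sigma(W) a in a Sigma(W).

    The Coxeter theory used on the way is derived from the inversion cocycle.
    Let N(w) be the set of reflections t such that w t is shorter than w.  It
    satisfies N(s) = {s} for s in S, and N(v w) is the symmetric difference of
    N(w) and N(v) ^ w; these two rules determine N.  Conversely, such an N is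
    obtained by letting the generators act on signed group elements and by
    checking the braid relations, which is where the presentation of W comes in
    (coxeter_inversion_cocycle).  The exchange property, the decomposition of W
    into minimal coset representatives times a parabolic subgroup, and the
    Mackey formula then follow from the two rules. *)

(** * The inversion cocycle *)

(** With N(w) = {t | inv w t}, the first clause says that N(v w) is the
    symmetric difference of N(w) and N(v) ^ w.  The argument t ranges over the
    whole group rather than over the reflections, so that inv can be read off
    an action on signed group elements. *)
Definition inversion_cocycle (gT : finGroupType) (W : {group gT})
    (S : {set gT}) (inv : gT -> gT -> bool) : Prop :=
  {in W &, forall v w t, inv (v * w) t = inv w t (+) inv v (t ^ w^-1)} /\
  {in S, forall s t, inv s t = (t == s)}.

Section SignedConjugation.

Variable gT : finGroupType.

Definition signed_conj (s : gT) (u : gT * bool) : gT * bool :=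
  (u.1 ^ s, u.2 (+) (u.1 == s)).

Lemma signed_conj_inj s : injective (signed_conj s).
Proof.
move=> [t b] [t' b'] [/conjg_inj -> /=].
by move/(congr1 (addb^~ (t' == s))); rewrite !addbK => ->.
Qed.

Definition signed_conj_perm s := perm (@signed_conj_inj s).

(** The letter at position j of the word s r s r ... flips the sign when it is
    the conjugate of t by the prefix before it, that is when t = (s r)^j s;
    these elements are the reflections of the dihedral group of s and r. *)
Lemma signed_conj_permX (s r : gT) k t (b : bool) : s * s = 1 -> r * r = 1 ->
  ((signed_conj_perm s * signed_conj_perm r) ^+ k) (t, b) =
  (t ^ ((s * r) ^+ k),
   b (+) \big[addb/false]_(j < k.*2) (t == (s * r) ^+ j * s)).
Proof.
move=> ss rr; have sV : s^-1 = s by apply/eqP; rewrite eq_invg_mul ss.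
have rV : r^-1 = r by apply/eqP; rewrite eq_invg_mul rr.
have flip j : ((s * r) ^+ j)^-1 = s * (s * r) ^+ j * s.
  elim: j => [|j IHj]; first by rewrite expg0 invg1 mulg1 ss.
  rewrite [in LHS]expgSr invMg IHj invMg sV rV expgS !mulgA ss mul1g.
  by rewrite -(mulgA r) ss mulg1.
elim: k => [|k IHk]; first by rewrite expg0 perm1 big_ord0 addbF conjg1.
rewrite expgSr permM IHk permM !permE /signed_conj /=.
rewrite doubleS !big_ord_recr /= -!conjgM !addbA; congr (_, _).
  by rewrite expgSr mulgA.
have conj_eq (x y z : gT) : (x ^ y == z) = (x == z ^ y^-1).
  by apply/eqP/eqP=> [<-|->]; rewrite ?conjgK ?conjgKV.
congr (_ (+) _ (+) _); rewrite conj_eq; congr (_ == _).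
  by rewrite conjgE invgK flip -!mulgA (mulgA s s) ss mul1g -addnn expgD mulgA.
rewrite conjgE invgK invMg sV flip -!mulgA (mulgA s s) ss mul1g.
by rewrite -addnn -addnS expgD expgS -!mulgA.
Qed.

(** The list (s r)^j s has period #[s * r], so that over two periods each
    reflection contributes two sign changes, which cancel. *)
Lemma signed_conj_perm_rel (s r : gT) : s * s = 1 -> r * r = 1 ->
  (signed_conj_perm s * signed_conj_perm r) ^+ #[s * r] = 1.
Proof.
move=> ss rr; apply/permP=> -[t b].
rewrite signed_conj_permX // perm1 expg_order conjg1; congr (_, _).
rewrite -addnn big_split_ord /=.
rewrite [X in _ (+) (_ (+) X)](eq_bigr (fun j : 'I__ =>
    t == (s * r) ^+ j * s)) => [|j _]; first by rewrite addbb addbF.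
by rewrite expgD expg_order mul1g.
Qed.

End SignedConjugation.

(** The signed conjugations satisfy the braid relations, hence extend to an
    action of W.  The permutations act on the right, so that the sign picked up
    by t under w records the inversions of w^-1. *)
Lemma coxeter_inversion_cocycle (gT : finGroupType) (W : {group gT})
    (S : {set gT}) :
  coxeter_system W S -> exists inv, inversion_cocycle W S inv.
Proof.
case=> genS oS /(_ {perm gT * bool} (@signed_conj_perm gT)).
have ss s : s \in S -> s * s = 1 by move/oS=> o; rewrite -expg2 -o expg_order.
case=> [s t Ss St|phi phiM phiS]; first by apply: signed_conj_perm_rel; auto.
have SW : {subset S <= W} by move=> s Ss; rewrite -genS mem_gen.
have phi1 : phi 1 = 1.
  by apply: (mulgI (phi 1)); rewrite -phiM ?group1 // !mulg1.
have phiE w : w \in W ->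
    forall t (b : bool), phi w (t, b) = (t ^ w, b (+) (phi w (t, false)).2).
  rewrite -{1}genS => /gen_prodgP[n [c Sc ->]].
  elim: n c Sc => [|n IHn] c Sc t b.
    by rewrite big_ord0 phi1 !perm1 conjg1 addbF.
  rewrite big_ord_recl; set w' := \prod_(i < n) _.
  have Ww' : w' \in W by apply: group_prod => i _; apply: SW.
  have IHw' t' (b' : bool) := IHn _ (fun i => Sc (lift ord0 i)) t' b'.
  rewrite (phiM _ _ (SW _ (Sc ord0)) Ww') !permM.
  rewrite (phiS _ (Sc ord0)) !permE /signed_conj /=.
  by rewrite IHw' [in RHS]IHw' conjgM addbA.
exists (fun w t => (phi w^-1 (t, false)).2); split=> [v w Wv Ww t|s Ss t].
  by rewrite invMg phiM ?groupV // permM (phiE w^-1) ?groupV //= phiE ?groupV.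
have -> : s^-1 = s by apply/eqP; rewrite eq_invg_mul ss.
by rewrite phiS // permE /=.
Qed.

(** * Length and inversions *)

Section CoxeterLength.

Variables (gT : finGroupType) (I : {set gT}).

Lemma coxlen_mem w : w \in <<I>> -> w \in I ^+ coxlen I w.
Proof.
by move=> Iw; rewrite /coxlen; case: ex_minnP => n /implyP Pn _; apply: Pn.
Qed.

Lemma coxlen_le w n : w \in I ^+ n -> coxlen I w <= n.
Proof.
move=> Inw; rewrite /coxlen; case: ex_minnP => m _; apply.
by rewrite Inw implybT.
Qed.

Lemma expsg_sub_gen n : I ^+ n \subset <<I>>.
Proof.
elim: n => [|n IHn]; first by rewrite sub1G.
by rewrite expgS mul_subG ?subset_gen.
Qed.

End CoxeterLength.

Section Inversions.

Variables (gT : finGroupType) (W : {group gT}) (S : {set gT}).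
Variable inv : gT -> gT -> bool.
Hypotheses (genW : <<S>> = W :> {set gT}) (invS : {in S, forall s, s * s = 1}).
Hypothesis cocyc : inversion_cocycle W S inv.

Let invM :
    {in W &, forall v w t, inv (v * w) t = inv w t (+) inv v (t ^ w^-1)} :=
  proj1 cocyc.

Let inv_gen : {in S, forall s t, inv s t = (t == s)} := proj2 cocyc.

Let sS : S \subset W.
Proof. by rewrite -genW subset_gen. Qed.

Lemma gen_subW (I : {set gT}) : I \subset S -> <<I>> \subset W.
Proof. by move=> sIS; rewrite -genW genS. Qed.

Lemma inv1 t : inv 1 t = false.
Proof.
have := invM (group1 W) (group1 W) t.
by rewrite mulg1 invg1 conjg1 addbb.
Qed.

Lemma invV w t : w \in W -> inv w^-1 t = inv w (t ^ w).
Proof.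
move=> Ww; have := @invM w w^-1 Ww (groupVr Ww) t.
by rewrite mulgV inv1 invgK; case: (inv w^-1 t); case: (inv w _).
Qed.

Section Parabolic.

Variable I : {set gT}.
Hypothesis sIS : I \subset S.

Let sIW : {subset I <= W}.
Proof. by move=> s /(subsetP sIS)/(subsetP sS). Qed.

Let sGW : {subset <<I>> <= W}.
Proof. exact/subsetP/gen_subW. Qed.

(** Strong exchange: right multiplication by an inversion t deletes a letter of
    any word for p, since unfolding the cocycle along the word shows that t is
    the conjugate of one of its letters by the suffix that follows it.  The
    letters are taken in I and not just in S, because the elements of W_I are
    studied below through their length relative to I. *)
Lemma expsg_exchange n p t : p \in I ^+ n -> inv p t ->
  exists2 m, n = m.+1 & p * t \in I ^+ m.
Proof.
elim: n p t => [|n IHn] p t; first by rewrite expg0 => /set1P->; rewrite inv1.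
rewrite expgSr => /mulsgP[q s Iq Is ->].
have Ws := sIW Is; have Wq := sGW (subsetP (expsg_sub_gen _ _) _ Iq).
have ss : s * s = 1 by apply: invS; apply: subsetP Is.
rewrite invM // inv_gen ?(subsetP sIS) //.
case: eqP => [-> _|_ /=]; first by exists n; rewrite // -mulgA ss mulg1.
case/(IHn _ _ Iq) => m -> Im; exists m.+1 => //.
rewrite expgSr; apply/mulsgP; exists (q * t ^ s^-1) s => //.
by rewrite conjgE invgK !mulgA mulgKV.
Qed.

Lemma coxlen_exchange p t : p \in <<I>> -> inv p t ->
  coxlen I (p * t) < coxlen I p.
Proof.
move=> Ip inv_pt.
by have [m -> /coxlen_le] := expsg_exchange (coxlen_mem Ip) inv_pt.
Qed.

Lemma coxlen_ascent p s : p \in <<I>> -> s \in I ->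
  (coxlen I p < coxlen I (p * s)) = ~~ inv p s.
Proof.
move=> Ip Is; have Ss := subsetP sIS s Is.
case inv_ps: (inv p s); first by rewrite ltnNge ltnW ?coxlen_exchange.
have Ips : p * s \in <<I>> by rewrite groupM // mem_gen.
rewrite -{1}(mulg1 p) -(invS Ss) mulgA coxlen_exchange //.
rewrite (invM (sGW Ip) (sIW Is)) inv_gen // eqxx.
by rewrite conjgE invgK mulgV mulg1 inv_ps.
Qed.

Lemma inv_sub_parabolic p t : p \in <<I>> -> inv p t -> t \in <<I>>.
Proof.
move/coxlen_mem; move: (coxlen I p) => n; elim: n p t => [|n IHn] p t.
  by rewrite expg0 => /set1P->; rewrite inv1.
rewrite expgSr => /mulsgP[q s Iq Is ->].
have Ws := sIW Is; have Wq := sGW (subsetP (expsg_sub_gen _ _) _ Iq).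
rewrite invM // inv_gen ?(subsetP sIS) //.
case: eqP => [-> _|_ /= /(IHn _ _ Iq)]; first exact: mem_gen.
by rewrite groupJr // groupV mem_gen.
Qed.

(** The last letter of a shortest word for p in the letters of I is an inversion
    of p, so only the empty word is left. *)
Lemma no_inv_parabolic p : p \in <<I>> -> {in I, forall s, ~~ inv p s} -> p = 1.
Proof.
move=> Ip noinv; have := coxlen_mem Ip.
case def_n: (coxlen I p) => [|n]; first by rewrite expg0 => /set1P.
rewrite expgSr => /mulsgP[q s Iq Is def_p].
have ss : s * s = 1 by apply: invS; apply: subsetP Is.
have := coxlen_ascent Ip Is; rewrite noinv // def_n def_p -mulgA ss mulg1.
by rewrite ltnNge ltnW // ltnS coxlen_le.
Qed.

End Parabolic.

(** This replaces the length condition by one that the cocycle rules can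
    handle. *)
Lemma mem_Xset (I : {set gT}) w : I \subset S ->
  (w \in Xset W S I) = (w \in W) && [forall s in I, ~~ inv w s].
Proof.
move=> sIS; rewrite inE; case Ww: (w \in W) => //=.
apply: eq_forallb_in => s Is.
by rewrite coxlen_ascent ?genW ?(subsetP sIS).
Qed.

(** * Minimal coset representatives *)

Section Cosets.

Variable I : {set gT}.
Hypothesis sIS : I \subset S.

Let sGW : {subset <<I>> <= W}.
Proof. exact/subsetP/gen_subW. Qed.

Lemma Xset_subW w : w \in Xset W S I -> w \in W.
Proof. by rewrite inE; case/andP. Qed.

(** An element u of minimal length in w W_I has no inversion t in W_I: by
    strong exchange u t would be a shorter element of the same coset. *)
Lemma parabolic_decomp w : w \in W ->
  exists2 u, u \in Xset W S I & exists2 p, p \in <<I>> &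
    (w = u * p /\ {in <<I>>, forall t, ~~ inv u t}).
Proof.
move=> Ww.
have [u] := arg_minnP (P := mem (w *: <<I>>)) (coxlen S) (lcoset_refl _ w).
case/lcosetP=> p Ip -> umin.
have Wu : w * p \in W by rewrite groupM // sGW.
have noinv : {in <<I>>, forall t, ~~ inv (w * p) t}.
  move=> t It; apply/negP=> inv_t.
  have := coxlen_exchange (subxx S) _ inv_t.
  rewrite genW ltnNge umin => [/(_ Wu)//|].
  by apply/lcosetP; exists (p * t); rewrite ?mulgA // groupM.
exists (w * p); last by exists p^-1; rewrite ?groupV // mulgK.
rewrite mem_Xset // Wu; apply/forall_inP=> s Is.
by rewrite noinv ?mem_gen.
Qed.

Lemma inv_parabolic_mul u p t : u \in W -> {in <<I>>, forall t, ~~ inv u t} ->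
  p \in <<I>> -> t \in <<I>> -> inv (u * p) t = inv p t.
Proof.
move=> Wu noinv Ip It.
rewrite (invM Wu (sGW Ip)) (negPf (noinv _ _)) ?addbF //.
by rewrite groupJ // groupV.
Qed.

(** Membership in X_I only excludes inversions from I.  To exclude all those in
    W_I, write w = v p with v minimal in the coset; w and p have the same
    inversions in W_I, so p has none in I and is trivial. *)
Lemma Xset_noinv u : u \in Xset W S I -> {in <<I>>, forall t, ~~ inv u t}.
Proof.
move=> Xu; have Wu := Xset_subW Xu.
have [v /Xset_subW Wv [p Ip [def_u noinv]]] := parabolic_decomp Wu.
suffices p1: p = 1 by rewrite def_u p1 mulg1.
apply: (no_inv_parabolic sIS Ip) => s Is.
rewrite -(inv_parabolic_mul Wv noinv) // ?mem_gen // -def_u.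
by move: Xu; rewrite mem_Xset // => /andP[_ /forall_inP/(_ s Is)].
Qed.

Lemma Xset_mul_inj u v p q : u \in Xset W S I -> v \in Xset W S I ->
  p \in <<I>> -> q \in <<I>> -> u * p = v * q -> u = v /\ p = q.
Proof.
move=> Xu Xv Ip Iq eq_w.
have def_v : v = u * (p * q^-1) by rewrite mulgA eq_w mulgK.
have Ipq : p * q^-1 \in <<I>> by rewrite groupM ?groupV.
have pq1 : p * q^-1 = 1.
  apply: (no_inv_parabolic sIS Ipq) => s Is.
  rewrite -(inv_parabolic_mul (Xset_subW Xu) (Xset_noinv Xu)) // ?mem_gen //.
  by rewrite -def_v (Xset_noinv Xv) ?mem_gen.
split; first by rewrite def_v pq1 mulg1.
by rewrite -(mulg1 p) -(mulVg q) mulgA pq1 mul1g.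
Qed.

Lemma big_Xset_parabolic (R : Type) (idx : R) (op : Monoid.com_law idx)
    (F : gT -> R) :
  \big[op/idx]_(w in W) F w =
  \big[op/idx]_(u in Xset W S I) \big[op/idx]_(p in <<I>>) F (u * p).
Proof.
pose mul (up : gT * gT) := up.1 * up.2.
have defW : W = mul @: setX (Xset W S I) <<I>> :> {set gT}.
  apply/setP=> w; apply/idP/imsetP=> [|[[u p] /setXP[/= Xu Ip] ->]].
    case/parabolic_decomp=> u Xu [p Ip [-> _]]; exists (u, p) => //.
    exact/setXP.
  by rewrite groupM ?(Xset_subW Xu) // sGW.
rewrite defW big_imset /= => [|[u p] [v q]].
  by rewrite pair_big_dep; apply: eq_bigl => -[u p]; rewrite inE.
move=> /setXP[/= Xu Ip] /setXP[/= Xv Iq].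
by case/(Xset_mul_inj Xu Xv Ip Iq) => -> ->.
Qed.

End Cosets.

(** * The Mackey formula *)

(** The heart of the Mackey formula.  On W_I ^ d neither d nor the factor u
    contributes to the inversions of u * p * d, so both p * d and u * p * d are
    controlled there by the inversions of p; off W_I ^ d, the inversions of
    p * d are those of d. *)
Lemma Xset_parabolic_mul (I J : {set gT}) u p d : I \subset S -> J \subset S ->
  u \in Xset W S I -> p \in <<I>> -> d^-1 \in Xset W S I ->
  (p * d \in Xset W S J) =
  (d \in Xset W S J) && (u * p * d \in Xset W S (J :&: <<I>> :^ d)).
Proof.
move=> sIS sJS Xu Ip Xd; have sGW := subsetP (gen_subW sIS).
have Wu := Xset_subW Xu; have Wp := sGW _ Ip.
have Wd : d \in W by rewrite -groupV (Xset_subW Xd).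
have noinv_u := Xset_noinv sIS Xu; have noinv_d := Xset_noinv sIS Xd.
have sKS : J :&: <<I>> :^ d \subset S
  by rewrite (subset_trans (subsetIl _ _)).
rewrite !mem_Xset // ?groupM //=.
have inv_dI s : s \in <<I>> :^ d -> ~~ inv d s.
  by rewrite mem_conjg => /noinv_d; rewrite invV // conjgKV.
have inv_dI' s : s ^ d^-1 \notin <<I>> -> inv (p * d) s = inv d s.
  move=> Is; rewrite invM //; case inv_p: (inv p _); last by rewrite addbF.
  by rewrite (inv_sub_parabolic sIS Ip inv_p) in Is.
rewrite Wd /=; apply/forall_inP/andP.
  move=> noinv; split; apply/forall_inP=> s.
    move=> Js; case: (boolP (s ^ d^-1 \in <<I>>)) => Is.
      by rewrite inv_dI ?mem_conjg.
    by rewrite -inv_dI' ?noinv.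
  case/setIP=> Js Ks; have Is : s ^ d^-1 \in <<I>> by rewrite -mem_conjg.
  have := noinv s Js; rewrite !invM ?groupM //.
  by rewrite (negPf (noinv_u _ _)) ?addbF // groupJ ?groupV.
case=> /forall_inP noinv_J /forall_inP noinv_K s Js.
case: (boolP (s ^ d^-1 \in <<I>>)) => Is; last by rewrite inv_dI' ?noinv_J.
have := noinv_K s; rewrite inE Js mem_conjg Is => /(_ isT).
rewrite !invM ?groupM //.
by rewrite (negPf (noinv_u _ _)) ?addbF // groupJ ?groupV.
Qed.

(** The minimal representatives of the double cosets W_I d W_J. *)
Definition Xdouble (I J : {set gT}) : {set gT} :=
  [set d | (d^-1 \in Xset W S I) && (d \in Xset W S J)].

(** Write v = p * d with p in W_I and d^-1 in X_I; for fixed d, the product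
    u * p runs over W, and Xset_parabolic_mul turns the condition on v into a
    condition on d and on the product u * v. *)
Lemma big_Xset_mul (R : Type) (idx : R) (op : Monoid.com_law idx)
    (F : gT -> R) (I J : {set gT}) : I \subset S -> J \subset S ->
  \big[op/idx]_(u in Xset W S I) \big[op/idx]_(v in Xset W S J) F (u * v) =
  \big[op/idx]_(d in Xdouble I J)
     \big[op/idx]_(w in Xset W S (J :&: <<I>> :^ d)) F w.
Proof.
move=> sIS sJS.
have big_right (G : gT -> R) : \big[op/idx]_(w in W) G w =
    \big[op/idx]_(d | d^-1 \in Xset W S I) \big[op/idx]_(p in <<I>>) G (p * d).
  rewrite (reindex_inj invg_inj) /=.
  rewrite (eq_bigl (mem W)) => [|w]; last exact: groupV.
  rewrite (big_Xset_parabolic sIS) (reindex_inj invg_inj) /=.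
  apply: eq_bigr => d _; rewrite (reindex_inj invg_inj) /=.
  apply: eq_big => [p | p _]; first exact: groupV.
  by rewrite invMg !invgK.
have XsubW K : {subset Xset W S K <= W} by move=> w; apply: Xset_subW.
have bigW (K : {set gT}) (G : gT -> R) :
    \big[op/idx]_(w in Xset W S K) G w =
    \big[op/idx]_(w in W) if w \in Xset W S K then G w else idx.
  rewrite -big_mkcondr; apply: eq_bigl => w; rewrite andbC.
  by case Xw: (w \in Xset W S K) => //; rewrite (XsubW _ _ Xw).
under eq_bigr => u _ do rewrite bigW big_right.
rewrite exchange_big big_mkcond [RHS]big_mkcond.
apply: eq_bigr => d _; rewrite [d \in Xdouble I J]in_set; case: ifP => //= Xd.
have Wd : d \in W by rewrite -groupV (XsubW _ _ Xd).
case Jd: (d \in Xset W S J); last first.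
  rewrite big1 // => u Xu; rewrite big1 // => p Ip.
  by rewrite (Xset_parabolic_mul sIS sJS Xu Ip Xd) Jd.
rewrite [RHS]bigW [RHS](reindex_inj (mulIg d)) /=.
rewrite [RHS](eq_bigl (mem W)) => [|w]; last by rewrite /= groupMr.
rewrite [RHS](big_Xset_parabolic sIS).
apply: eq_bigr => u Xu; apply: eq_bigr => p Ip.
by rewrite (Xset_parabolic_mul sIS sJS Xu Ip Xd) Jd /= mulgA.
Qed.

(** Put t = s ^ d^-1.  As d^-1 belongs to X_I, d has no inversion in W_I ^ d,
    which is stable under conjugation by s.  So the only inversion of
    t * d = d * s in W_I ^ d is s, and t is its own only inversion in W_I.  As
    t <> 1, it has an inversion in I, which can only be t. *)
Lemma conj_simple_parabolic (I : {set gT}) d s : I \subset S -> s \in S ->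
  d^-1 \in Xset W S I -> s ^ d^-1 \in <<I>> -> s ^ d^-1 \in I.
Proof.
move=> sIS Ss XId It; set t := s ^ d^-1 in It *.
have Wd : d \in W by rewrite -groupV (Xset_subW XId).
have Ws := subsetP sS _ Ss; have Wt := subsetP (gen_subW sIS) _ It.
have dt : t * d = d * s by rewrite /t conjgE invgK !mulgA mulgKV.
have noinv_d := Xset_noinv sIS XId.
have inv_dI r : r \in <<I>> -> inv d (r ^ d) = false.
  by move/noinv_d; rewrite invV // => /negPf.
have inv_t r : r \in <<I>> -> inv t r = (r == t).
  move=> Ir; have := congr1 (inv^~ (r ^ d)) dt => /=.
  rewrite (invM Wt Wd) (invM Wd Ws) conjgK inv_dI // (inv_gen Ss) addFb => ->.
  have -> : (r ^ d) ^ s^-1 = (r ^ t^-1) ^ d.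
    rewrite -!conjgM; congr (_ ^ _).
    by rewrite -[RHS](mulgK s) -(mulgA _ d) -dt mulKg.
  rewrite inv_dI ?groupJ ?groupV // addbF /t.
  by rewrite -(inj_eq (@conjg_inj _ d^-1)) conjgK.
apply/negPn/negP=> notIt.
have t1 : t = 1.
  apply: (no_inv_parabolic sIS It) => r Ir.
  by rewrite inv_t ?mem_gen //; apply: contraNneq notIt => <-.
by have := inv_t t It; rewrite {1}t1 inv1 eqxx.
Qed.

(** The coset W_I u contains u W_J, so the minimal element of W_I u is minimal
    on the right for J too. *)
Lemma exists_Xdouble (I J : {set gT}) u : I \subset S -> J \subset S ->
  u \in W -> J \subset <<I>> :^ u ->
  exists2 d, d \in Xdouble I J & J \subset <<I>> :^ d.
Proof.
move=> sIS sJS Wu sJIu.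
have [v Xv [p Ip [def_u noinv]]] := parabolic_decomp sIS (groupVr Wu).
have Wv := Xset_subW Xv.
have eqJ : <<I>> :^ u = <<I>> :^ v^-1.
  by rewrite -(invgK u) def_u invMg conjsgM (conjGid (groupVr Ip)).
rewrite eqJ in sJIu; exists v^-1 => //.
rewrite in_set invgK Xv mem_Xset // groupV Wv /=.
apply/forall_inP=> s Js; rewrite invV //; apply: noinv.
by have := subsetP sJIu s Js; rewrite mem_conjgV.
Qed.

(** * Products in the descent algebra *)

Lemma mul_xelt (I J : {set gT}) : I \subset S -> J \subset S ->
  (xelt W S I *m xelt W S J =
   \sum_(d in Xdouble I J) xelt W S (J :&: <<I>> :^ d))%R.
Proof.
move=> sIS sJS; rewrite /xelt /gset_mx -(big_Xset_mul _ _ sIS sJS) mulmx_suml.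
apply: eq_bigr => u Xu; rewrite mulmx_sumr; apply: eq_bigr => v Xv.
by rewrite repr_mxM // (Xset_subW Xu, Xset_subW Xv).
Qed.

Lemma cox_class_refl (I : {set gT}) : I \subset S -> I \in cox_class W S I.
Proof.
move=> sIS; rewrite in_set powersetE sIS; apply/existsP; exists 1.
by rewrite group1 invg1 conjsg1 eqxx.
Qed.

Lemma class_le_subset (I J : {set gT}) : I \subset J -> J \subset S ->
  class_le (cox_class W S I) (cox_class W S J).
Proof.
move=> sIJ sJS; apply/existsP; exists I.
rewrite cox_class_refl ?(subset_trans sIJ) //.
by apply/existsP; exists J; rewrite cox_class_refl.
Qed.

Lemma class_le_Xdouble (I J : {set gT}) d : I \subset S -> J \subset S ->
  d \in Xdouble I J ->
  class_le (cox_class W S (J :&: <<I>> :^ d)) (cox_class W S I).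
Proof.
move=> sIS sJS; rewrite in_set => /andP[XId /Xset_subW Wd].
have sKI : (J :&: <<I>> :^ d) :^ d^-1 \subset I.
  apply/subsetP=> r; rewrite mem_conjgV => /setIP[Jr]; rewrite mem_conjg => Ir.
  have := conj_simple_parabolic sIS (subsetP sJS _ Jr) XId Ir.
  by rewrite conjgK.
apply/existsP; exists ((J :&: <<I>> :^ d) :^ d^-1); apply/andP; split.
  rewrite in_set powersetE (subset_trans sKI sIS); apply/existsP; exists d.
  by rewrite Wd eqxx.
by apply/existsP; exists I; rewrite cox_class_refl.
Qed.

Lemma class_le_conj (I J : {set gT}) :
  class_le (cox_class W S J) (cox_class W S I) ->
  exists2 u, u \in W & J \subset <<I>> :^ u.
Proof.
case/existsP=> J1 /andP[].
rewrite in_set => /andP[_ /existsP[w /andP[Ww /eqP->]]].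
case/existsP=> I1 /andP[].
rewrite in_set => /andP[_ /existsP[v /andP[Wv /eqP->]]].
rewrite -(conjSg _ _ w) -conjsgM -conjsgM mulVg conjsg1 => sJI.
exists (v^-1 * w); first by rewrite groupM ?groupV.
by apply: subset_trans sJI _; rewrite conjSg subset_gen.
Qed.

End Inversions.

Section DescentAlgebra.

Variables (gT : finGroupType) (W : {group gT}) (S : {set gT}).

Local Open Scope ring_scope.

(** The function coord yields a decomposition of any element of the span of a
    family, even without knowing that the family is free. *)
Lemma Sigma_xiE a : a \in Sigma W S ->
  a = \sum_(I in powerset S) xi S I a *: xelt W S I.
Proof.
have -> : Sigma W S = <<xtuple W S>>%VS.
  rewrite /Sigma /SigmaF span_def big_tuple [LHS]big_enum_val.
  by apply: eq_bigr => i _; rewrite tnth_mktuple.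
move/coord_span=> {1}->; rewrite [RHS]big_enum_val; apply: eq_bigr => i _.
by rewrite -tnth_nth tnth_mktuple /xi enum_valK_in.
Qed.

Lemma xelt_SigmaF (F : {set {set gT}}) I :
  I \in F -> xelt W S I \in SigmaF W S F.
Proof.
by move=> FI; apply: (subvP (sumv_sup I FI (subvv _))); rewrite memv_line.
Qed.

Lemma SigmaF_sub (F : {set {set gT}}) (U : {vspace 'M[rat]_#|W|}) :
  {in F, forall I, xelt W S I \in U} -> (SigmaF W S F <= U)%VS.
Proof. by move=> FU; apply/subv_sumP=> I FI; rewrite -memvE FU. Qed.

End DescentAlgebra.

(* linfun (mulmx a) and linfun (mulmxr a) are left and right multiplication by
   a, so the images below are a Sigma(W) and Sigma(W) a. *)
Theorem proposition3p6 (gT : finGroupType) (W : {group gT}) (S : {set gT})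
    (a : 'M[rat]_#|W|) (coxWS : coxeter_system W S) (a_pos : Sigma_plus S a) :
  (linfun (mulmx a) @: Sigma W S)%VS = SigmaF W S (Feq S a) /\
  (linfun (mulmxr a) @: Sigma W S <= linfun (mulmx a) @: Sigma W S)%VS.
Proof.
have [inv cocyc] := coxeter_inversion_cocycle coxWS.
have [genW oS _] := coxWS; have [Sa xi_ge0] := a_pos.
have invS : {in S, forall s, s * s = 1}.
  by move=> s Ss; rewrite -expg2 -(oS s Ss) expg_order.
have a_mul (J : {set gT}) : J \subset S -> (a *m xelt W S J =
    \sum_(I in powerset S) \sum_(d in Xdouble W S I J)
       xi S I a *: xelt W S (J :&: <<I>> :^ d))%R.
  move=> sJS; rewrite {1}(Sigma_xiE Sa) mulmx_suml; apply: eq_bigr => I.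
  rewrite powersetE => sIS.
  by rewrite -scalemxAl (mul_xelt genW invS cocyc) // scaler_sumr.
have FeqK (I J : {set gT}) d : I \subset S -> J \subset S -> xi S I a != 0%R ->
    d \in Xdouble W S I J -> J :&: <<I>> :^ d \in Feq S a.
  move=> sIS sJS xiI XIJd.
  rewrite in_set powersetE (subset_trans (subsetIl _ _)) //=.
  apply/existsP; exists I; rewrite powersetE sIS xiI /=.
  exact: (class_le_Xdouble genW invS cocyc).
have Sx (J : {set gT}) : J \subset S -> xelt W S J \in Sigma W S.
  by move=> sJS; apply: xelt_SigmaF; rewrite powersetE.
have imgE : (linfun (mulmx a) @: Sigma W S)%VS = SigmaF W S (Feq S a).
  apply/eqP; rewrite eqEsubv; apply/andP; split.
    rewrite limg_sum; apply/subv_sumP=> J; rewrite powersetE => sJS.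
    rewrite limg_line -memvE lfunE /= a_mul //.
    apply: memv_suml => I; rewrite powersetE => sIS; apply: memv_suml => d XIJd.
    have [->|xiI] := eqVneq (xi S I a) 0%R; first by rewrite scale0r mem0v.
    by apply/memvZ/xelt_SigmaF/FeqK.
  apply: SigmaF_sub => J; have [n] := ubnP #|J|.
  elim: n => // n IHn in J *; rewrite ltnS => leJn FJ.
  have sJS : J \subset S by move: FJ; rewrite in_set powersetE => /andP[].
  (* c is the coefficient of x_J in the expansion of a x_J given by a_mul. *)
  pose c := (\sum_(I in powerset S)
    \sum_(d in Xdouble W S I J | J :&: <<I>> :^ d == J) xi S I a)%R.
  have c_neq0 : c != 0%R.
    move: FJ; rewrite in_set => /andP[_ /existsP[I /and3P[]]].
    rewrite powersetE => sIS xiI /class_le_conj[u Wu sJIu].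
    have [d XIJd sJId] := exists_Xdouble genW invS cocyc sIS sJS Wu sJIu.
    apply: lt0r_neq0; rewrite /c (bigD1 I) ?powersetE //=.
    rewrite (bigD1 d) /=; last first.
      by rewrite XIJd; apply/eqP/setIidPl.
    (* The term of (I, d) is positive, and the other ones are nonnegative. *)
    rewrite -addrA ltr_wpDr ?lt0r ?xiI ?xi_ge0 // addr_ge0 //.
      by apply: sumr_ge0 => e _; apply: xi_ge0.
    apply: sumr_ge0 => K /andP[]; rewrite powersetE => sKS _.
    by apply: sumr_ge0 => e _; apply: xi_ge0.
  have Uax : (a *m xelt W S J)%R \in (linfun (mulmx a) @: Sigma W S)%VS.
    by have := memv_img (linfun (mulmx a)) (Sx J sJS); rewrite lfunE.
  have : (c *: xelt W S J)%R \in (linfun (mulmx a) @: Sigma W S)%VS.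
    have cxE : (c *: xelt W S J = \sum_(I in powerset S)
        \sum_(d in Xdouble W S I J | J :&: <<I>> :^ d == J)
          xi S I a *: xelt W S (J :&: <<I>> :^ d))%R.
      rewrite scaler_suml; apply: eq_bigr => I _; rewrite scaler_suml.
      by apply: eq_bigr => d /andP[_ /eqP->].
    move: Uax; rewrite a_mul //.
    under eq_bigr => I _ do
      rewrite (bigID (fun d => J :&: <<I>> :^ d == J)) /=.
    rewrite big_split /= rpredDr; last first.
      apply: memv_suml => I; rewrite powersetE => sIS.
      apply: memv_suml => d /andP[XIJd neqJ].
      have [->|xiI] := eqVneq (xi S I a) 0%R; first by rewrite scale0r mem0v.
      apply/memvZ/IHn; last exact: FeqK.
      by apply: leq_trans leJn; rewrite proper_card // properEneq neqJ subsetIl.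
    by rewrite -cxE.
  by rewrite rpredZeq (negPf c_neq0).
split=> //; rewrite imgE limg_sum.
apply/subv_sumP=> I; rewrite powersetE => sIS.
rewrite limg_line -memvE lfunE /= {1}(Sigma_xiE Sa) mulmx_sumr.
apply: memv_suml => J; rewrite powersetE => sJS; rewrite -scalemxAr.
have [->|xiJ] := eqVneq (xi S J a) 0%R; first by rewrite scale0r mem0v.
apply: memvZ; rewrite (mul_xelt genW invS cocyc) //.
apply: memv_suml => d _; apply: xelt_SigmaF.
rewrite in_set powersetE (subset_trans (subsetIl _ _)) //=.
apply/existsP; exists J; rewrite powersetE sJS xiJ /=.
by apply: class_le_subset; rewrite ?subsetIl.
Qed.
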